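(* Let $\hbar\neq 0$, $h=2i\hbar$, let $\mathcal{A}$ be the central extension of $U(u(2)_h)$ by the quantum radius $r_\hbar$, and let $\partial_x,\partial_y,\partial_z:\mathcal{A}\to\mathcal{A}$ be the quantum partial derivatives (all defined in the context). For every constant $g\in\mathbb{R}$, the noncommutative field $$\mathbf{H}=(H_1,H_2,H_3)=\frac{g}{r_\hbar\,(r_\hbar^2-\hbar^2)}\,(x,y,z)\in\mathcal{A}^3$$ satisfies the system $\mathrm{div}\,\mathbf{H}=0$, $\mathrm{rot}\,\mathbf{H}=(0,0,0)$, where $$\mathrm{div}\,\mathbf{H}=\partial_x(H_1)+\partial_y(H_2)+\partial_z(H_3),$$ $$\mathrm{rot}\,\mathbf{H}=\bigl(\partial_y(H_3)-\partial_z(H_2),\ \partial_z(H_1)-\partial_x(H_3),\ \partial_x(H_2)-\partial_y(H_1)\bigr).$$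
   Context: Fix a nonzero parameter $\hbar\in\mathbb{C}$ and put $h=2i\hbar$. $U(u(2)_h)$ is the unital associative $\mathbb{C}$-algebra generated by $t,x,y,z$ with relations $[x,y]=hz$, $[y,z]=hx$, $[z,x]=hy$, and $t$ central; $U(su(2)_h)$ is the subalgebra generated by $x,y,z$. Let $\mathbb{C}(t,r_\hbar)$ be the field of rational functions in two commuting variables $t$ and $r_\hbar$ ($r_\hbar$ is called the quantum radius). Put $$\mathcal{A}=\bigl(U(su(2)_h)\otimes\mathbb{C}(t,r_\hbar)\bigr)/\langle x^2+y^2+z^2-r_\hbar^2+\hbar^2\rangle ,$$ so that $t$ and $r_\hbar$ are central in $\mathcal{A}$. Quantum partial derivatives on $\mathcal{A}$. Let $I$ be the $4\times4$ identity matrix and let $$X=\begin{pmatrix}0&-1&0&0\\1&0&0&0\\0&0&0&-1\\0&0&1&0\end{pmatrix},\quad Y=\begin{pmatrix}0&0&-1&0\\0&0&0&1\\1&0&0&0\\0&-1&0&0\end{pmatrix},\quad Z=\begin{pmatrix}0&0&0&-1\\0&0&-1&0\\0&1&0&0\\1&0&0&0\end{pmatrix}.$$ Let $\hat\Theta:\mathcal{A}\to \mathrm{Mat}_4(\mathcal{A})$ be the unital $\mathbb{C}$-algebra homomorphism determined by $$\hat\Theta(t)=(t+i\hbar)I,\quad \hat\Theta(x)=xI+i\hbar X,\quad \hat\Theta(y)=yI+i\hbar Y,\quad \hat\Theta(z)=zI+i\hbar Z,$$ $$\hat\Theta(r_\hbar)=\frac{1}{r_\hbar}\begin{pmatrix}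 r_\hbar^2+\hbar^2&-i\hbar x&-i\hbar y&-i\hbar z\\ i\hbar x&r_\hbar^2+\hbar^2&-i\hbar z&i\hbar y\\ i\hbar y&i\hbar z&r_\hbar^2+\hbar^2&-i\hbar x\\ i\hbar z&-i\hbar y&i\hbar x&r_\hbar^2+\hbar^2\end{pmatrix},$$ and $\hat\Theta(f(t,r_\hbar))=f(\hat\Theta(t),\hat\Theta(r_\hbar))$ for $f\in\mathbb{C}(t,r_\hbar)$. For $a\in\mathcal{A}$ the quantum partial derivatives are defined by $$\text{first column of }\hat\Theta(a)=i\hbar\,\bigl(\tilde\partial_t(a),\partial_x(a),\partial_y(a),\partial_z(a)\bigr)^T,\qquad \partial_t(a)=\tilde\partial_t(a)-\tfrac{2}{h}a .$$ *)

(* Defs.v *)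
From HB Require Import structures.
From mathcomp Require Import all_boot all_order all_algebra.
From mathcomp Require Import boolp reals.
From mathcomp Require Import complex monalg.

Set Implicit Arguments.
Unset Strict Implicit.
Unset Printing Implicit Defensive.

Import GRing.Theory Num.Theory.
Local Open Scope ring_scope.
Local Open Scope quotient_scope.

(* The library only divides commutative rings by proper ideals. Here S is an
   arbitrary ring and S / <G> is the quotient by the two-sided ideal generated
   by G : S -> Prop. The quotient is a pzRingType (1 = 0 is not excluded a
   priori), so no proof that <G> is proper is built into the definition. *)
Section TwoSidedQuotient.
Variables (S : pzRingType) (G : S -> Prop).

Inductive in_ideal : S -> Prop :=
| in_ideal_gen a : G a -> in_ideal a
| in_ideal0 : in_ideal 0
| in_idealB a b : in_ideal a -> in_ideal b -> in_ideal (a - b)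
| in_idealMl c a : in_ideal a -> in_ideal (c * a)
| in_idealMr c a : in_ideal a -> in_ideal (a * c).

Definition tsideal : {pred S} := fun a => `[< in_ideal a >].

Fact tsideal_zmod_closed : zmod_closed tsideal.
Proof.
split; first by apply/asboolP; exact: in_ideal0.
by move=> a b /asboolP ? /asboolP ?; apply/asboolP; exact: in_idealB.
Qed.

HB.instance Definition _ :=
  GRing.isZmodClosed.Build S tsideal tsideal_zmod_closed.

Definition tsquot : Type := Quotient.quot tsideal.

HB.instance Definition _ := GRing.Zmodule.on tsquot.
HB.instance Definition _ := EqQuotient.on tsquot.

Definition tsquot_class (a : S) : tsquot := \pi_tsquot a.

Lemma tsquot_classP (a b : S) :
  tsquot_class a = tsquot_class b <-> in_ideal (a - b).
Proof.
split=> [/eqP|ab]; last apply/eqP.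
  by rewrite /tsquot_class -Quotient.idealrBE => /asboolP.
by rewrite /tsquot_class -Quotient.idealrBE; apply/asboolP.
Qed.

Lemma tsquot_class_repr (u : tsquot) : tsquot_class (repr u) = u.
Proof. exact: reprK. Qed.

Lemma tsquot_classB : {morph tsquot_class : a b / a - b}.
Proof. by move=> a b; rewrite /tsquot_class !piE. Qed.

Lemma tsquot_classD : {morph tsquot_class : a b / a + b}.
Proof. by move=> a b; rewrite /tsquot_class !piE. Qed.

Definition tsquot_one : tsquot := tsquot_class 1.
Definition tsquot_mul (u v : tsquot) : tsquot := tsquot_class (repr u * repr v).

Lemma tsquot_classM (a b : S) :
  tsquot_class (a * b) = tsquot_mul (tsquot_class a) (tsquot_class b).
Proof.
apply/tsquot_classP.
set a' := repr _; set b' := repr _.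
have -> : a * b - a' * b' = (a - a') * b - a' * (b' - b).
  by rewrite mulrBl mulrBr opprB addrA subrK.
apply: in_idealB; [apply: in_idealMr|apply: in_idealMl];
  by apply/tsquot_classP; rewrite tsquot_class_repr.
Qed.

Local Lemma tsquot_ind (P : tsquot -> Prop) :
  (forall a, P (tsquot_class a)) -> forall u, P u.
Proof. by move=> Pc u; rewrite -(tsquot_class_repr u). Qed.

Fact tsquot_mulA : associative tsquot_mul.
Proof.
elim/tsquot_ind=> a; elim/tsquot_ind=> b; elim/tsquot_ind=> c.
by rewrite -!tsquot_classM mulrA.
Qed.

Fact tsquot_mul1l : left_id tsquot_one tsquot_mul.
Proof. by elim/tsquot_ind=> a; rewrite -tsquot_classM mul1r. Qed.

Fact tsquot_mulr1 : right_id tsquot_one tsquot_mul.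
Proof. by elim/tsquot_ind=> a; rewrite -tsquot_classM mulr1. Qed.

Fact tsquot_mulDl : left_distributive tsquot_mul +%R.
Proof.
elim/tsquot_ind=> a; elim/tsquot_ind=> b; elim/tsquot_ind=> c.
by rewrite -tsquot_classD -!tsquot_classM mulrDl tsquot_classD.
Qed.

Fact tsquot_mulDr : right_distributive tsquot_mul +%R.
Proof.
elim/tsquot_ind=> a; elim/tsquot_ind=> b; elim/tsquot_ind=> c.
by rewrite -tsquot_classD -!tsquot_classM mulrDr tsquot_classD.
Qed.

HB.instance Definition _ := GRing.Zmodule_isPzRing.Build tsquot
  tsquot_mulA tsquot_mul1l tsquot_mulr1 tsquot_mulDl tsquot_mulDr.

Fact tsquot_class_zmod_morphism : zmod_morphism tsquot_class.
Proof. exact: tsquot_classB. Qed.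

Fact tsquot_class_monoid_morphism : monoid_morphism tsquot_class.
Proof. by split=> // a b; rewrite tsquot_classM. Qed.

HB.instance Definition _ :=
  GRing.isZmodMorphism.Build S tsquot tsquot_class tsquot_class_zmod_morphism.
HB.instance Definition _ :=
  GRing.isMonoidMorphism.Build S tsquot tsquot_class
    tsquot_class_monoid_morphism.

End TwoSidedQuotient.

(* U(su(2)_h) over a field K: the free algebra K<x, y, z>, with x, y, z the
   generators 0, 1, 2, modulo [x,y] = hz, [y,z] = hx, [z,x] = hy. *)
Section EnvelopingAlgebra.
Variables (K : fieldType) (h : K).

Definition free3 := {malg K[{fmonom 'I_3}]}.

Definition free_gen (i : 'I_3) : free3 := mkmalgU (fmu i) 1.

Local Notation X0 := (free_gen (inord 0)).
Local Notation X1 := (free_gen (inord 1)).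
Local Notation X2 := (free_gen (inord 2)).

Inductive su2_rel : free3 -> Prop :=
| su2_rel_xy : su2_rel (X0 * X1 - X1 * X0 - h *: X2)
| su2_rel_yz : su2_rel (X1 * X2 - X2 * X1 - h *: X0)
| su2_rel_zx : su2_rel (X2 * X0 - X0 * X2 - h *: X1).

Definition su2_env := tsquot su2_rel.
HB.instance Definition _ := GRing.PzRing.on su2_env.

Definition su2_gen (i : 'I_3) : su2_env := tsquot_class su2_rel (free_gen i).
Definition su2_scalar (c : K) : su2_env := tsquot_class su2_rel (c *: 1).

End EnvelopingAlgebra.

Section QuantumRadiusExtension.
Variables (R : realType) (hbar : R[i]).

(* C(t, r_hbar), as the fraction field of C[r_hbar][t]. *)
Definition ratfun := {fraction {poly {poly R[i]}}}.
HB.instance Definition _ := GRing.Field.on ratfun.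

Definition cst (c : R[i]) : ratfun := tofrac (c%:P%:P).
Definition tvar : ratfun := tofrac 'X.
Definition rvar : ratfun := tofrac ('X%:P).

Definition hpar : R[i] := 2 * 'i%C * hbar.

(* U(su(2)_h) (x)_C C(t, r_hbar): scalar extension of an algebra presented over
   C is the algebra with the same presentation over C(t, r_hbar). *)
Definition su2_ext := su2_env (cst hpar).
HB.instance Definition _ := GRing.PzRing.on su2_ext.

Definition casimir_rel (a : su2_ext) : Prop :=
  a = su2_gen _ (inord 0) ^+ 2 + su2_gen _ (inord 1) ^+ 2
      + su2_gen _ (inord 2) ^+ 2
      - su2_scalar _ (rvar ^+ 2) + su2_scalar _ (cst hbar ^+ 2).

Definition calA := tsquot casimir_rel.
HB.instance Definition _ := GRing.PzRing.on calA.

Definition genx : calA := tsquot_class casimir_rel (su2_gen _ (inord 0)).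
Definition geny : calA := tsquot_class casimir_rel (su2_gen _ (inord 1)).
Definition genz : calA := tsquot_class casimir_rel (su2_gen _ (inord 2)).

(* The (central) image of f(t, r_hbar) in A. *)
Definition fA (f : ratfun) : calA := tsquot_class casimir_rel (su2_scalar _ f).
Definition cA (c : R[i]) : calA := fA (cst c).
Definition ihbar : calA := cA ('i%C * hbar).

Definition mx4 (rows : seq (seq calA)) : 'M[calA]_4 :=
  \matrix_(i < 4, j < 4) nth 0 (nth [::] rows i) j.

Definition matX : 'M[calA]_4 := mx4
  [:: [:: 0; -1;  0;  0];
      [:: 1;  0;  0;  0];
      [:: 0;  0;  0; -1];
      [:: 0;  0;  1;  0]].

Definition matY : 'M[calA]_4 := mx4
  [:: [:: 0;  0; -1;  0];
      [:: 0;  0;  0;  1];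
      [:: 1;  0;  0;  0];
      [:: 0; -1;  0;  0]].

Definition matZ : 'M[calA]_4 := mx4
  [:: [:: 0;  0;  0; -1];
      [:: 0;  0; -1;  0];
      [:: 0;  1;  0;  0];
      [:: 1;  0;  0;  0]].

Definition theta_r : 'M[calA]_4 :=
  let d := fA (rvar ^+ 2 + cst hbar ^+ 2) in
  let: (x, y, z) := (ihbar * genx, ihbar * geny, ihbar * genz) in
  fA rvar^-1 *: mx4
    [:: [:: d; - x; - y; - z];
        [:: x;   d; - z;   y];
        [:: y;   z;   d; - x];
        [:: z; - y;   x;   d]].

(* The conditions that determine the homomorphism Theta. The prescription
   Theta (f (t, r_hbar)) = f (Theta t, Theta r_hbar) for rational f needs no
   clause: a C-linear unital ring morphism satisfies it for polynomials, and
   sends the inverse of a polynomial to the inverse of its image. *)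
Record is_Theta (Theta : {rmorphism calA -> 'M[calA]_4}) : Prop := {
  Theta_C : forall c : R[i], Theta (cA c) = (cA c)%:M;
  Theta_t : Theta (fA tvar) = (fA tvar + ihbar)%:M;
  Theta_x : Theta genx = genx%:M + ihbar *: matX;
  Theta_y : Theta geny = geny%:M + ihbar *: matY;
  Theta_z : Theta genz = genz%:M + ihbar *: matZ;
  Theta_r : Theta (fA rvar) = theta_r
}.

(* first column of Theta a = i hbar (dt~ a, dx a, dy a, dz a)^T *)
Section QuantumDerivatives.
Variable Theta : {rmorphism calA -> 'M[calA]_4}.

Definition qder (k : 'I_4) (a : calA) : calA :=
  cA ('i%C * hbar)^-1 * Theta a k ord0.

Definition dx : calA -> calA := qder (inord 1).
Definition dy : calA -> calA := qder (inord 2).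
Definition dz : calA -> calA := qder (inord 3).

Definition qdiv (H : calA * calA * calA) : calA :=
  let: (H1, H2, H3) := H in dx H1 + dy H2 + dz H3.

Definition qrot (H : calA * calA * calA) : calA * calA * calA :=
  let: (H1, H2, H3) := H in
  (dy H3 - dz H2, dz H1 - dx H3, dx H2 - dy H1).
End QuantumDerivatives.

Definition monopole (g : R) : calA * calA * calA :=
  let c := fA (cst (g%:C)%C / (rvar * (rvar ^+ 2 - cst hbar ^+ 2))) in
  (c * genx, c * geny, c * genz).

End QuantumRadiusExtension.

(* Main.v *)
Require Import Defs.
From HB Require Import structures.
From mathcomp Require Import all_boot all_order all_algebra.
From mathcomp Require Import reals complex.
From mathcomp Require Import monalg ring.

Set Implicit Arguments.
Unset Strict Implicit.
Unset Printing Implicit Defensive.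

Import GRing.Theory.
Local Open Scope ring_scope.

(** Inside the matrices over the algebra A, the constant matrices X, Y, Z are
    quaternion units that commute with the scalar matrices of x, y, z. Let
    e = i hbar, so that h = 2 e and the Casimir relation reads
    x^2 + y^2 + z^2 = r^2 + e^2. The single noncentral matrix that matters is
    N = x X + y Y + z Z: the quaternion relations together with those of su(2)
    give N^2 = - (r^2 + e^2) + 2 e N ([sqr_quaternion], [sqr_posmx]). Hence the
    matrices a + b N with central a, b form a commutative ring, in which products
    are computed from two coefficients in the field of rational functions
    ([mul_binomial]).

    The image of r under Theta is P = ((r^2 - e^2) + e N) / r, which lies in this
    ring ([radius_imageE]) and satisfies (P - r)^2 = hbar^2; so Theta acts on
    functions of r as if r were replaced by the two values r + hbar and
    r - hbar. The image of 1 / (r (r^2 + e^2)) must therefore be of the form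
    a + b N, and interpolation at these two values gives
    a = 1 / (r (r^2 + 4 e^2)) and b = - 3 e a / (r^2 + e^2). It is enough to
    check that this matrix is inverse to P (P^2 + e^2) ([radial_inverse]).

    For every c with Theta c = a + b N, the first columns of Theta (c x),
    Theta (c y), Theta (c z) can be read off. The rotation of c (x, y, z)
    vanishes whatever a and b are, because its components are multiples of
    [y, z] - 2 e x and of its cyclic analogues ([rot_radial]); the divergence is
    proportional to 3 e a + b (r^2 + e^2) ([div_radial]), which is zero exactly
    for the ratio b / a found above.

    The argument uses only the commutators, the Casimir relation and the
    centrality of the functions of t and r, so it is carried out over an abstract
    ring B with a central morphism from a field F; the last part checks these
    facts in A, where the denominators r, r^2 - hbar^2 and r^2 - 4 hbar^2 are
    nonzero because r is transcendental over the complex numbers. *)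

(** * Relations under homomorphisms and in quotients *)

Lemma rmorph_commutator (S T : pzRingType) (f : {rmorphism S -> T}) a b s c :
  a * b - b * a = s * c -> f a * f b - f b * f a = f s * f c.
Proof. by rewrite -!rmorphM -rmorphB => ->. Qed.

Lemma rmorph_sum_sqr (S T : pzRingType) (f : {rmorphism S -> T}) a b c d :
  a ^+ 2 + b ^+ 2 + c ^+ 2 = d -> f a ^+ 2 + f b ^+ 2 + f c ^+ 2 = f d.
Proof. by rewrite -!rmorphXn -!rmorphD => ->. Qed.

Lemma rmorph_casimir (S T : pzRingType) (f : {rmorphism S -> T}) a b c d e :
  f (a ^+ 2 + b ^+ 2 + c ^+ 2 - d + e) = 0 ->
  f a ^+ 2 + f b ^+ 2 + f c ^+ 2 = f (d - e).
Proof.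
rewrite -!rmorphXn -!rmorphD => Df; apply/subr0_eq.
by rewrite -rmorphB opprB addrA addrAC.
Qed.

Lemma tsquot_gen0 (S : pzRingType) (G : S -> Prop) (a : S) :
  G a -> tsquot_class G a = 0.
Proof.
move=> Ga; rewrite -(rmorph0 (tsquot_class G)).
by apply/tsquot_classP; rewrite subr0; exact: in_ideal_gen.
Qed.

Lemma tsquot_commutator (S : pzRingType) (G : S -> Prop) (a b c : S) :
  G (a * b - b * a - c) ->
  tsquot_class G a * tsquot_class G b - tsquot_class G b * tsquot_class G a
    = tsquot_class G c.
Proof.
move/tsquot_gen0/eqP; rewrite !rmorphB !rmorphM subr_eq0 => /eqP; exact.
Qed.

(** * Quaternion units over a noncommutative ring *)

(** Hamilton's observation that the squares and one product determine the whole
    multiplication table. *)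
Lemma quaternion_table (B : pzRingType) (I J K : B) :
  [/\ I * I = -1, J * J = -1, K * K = -1 & I * J = K] ->
  [/\ J * K = I, K * I = J, J * I = - K, K * J = - I & I * K = - J].
Proof.
move=> [II JJ KK IJ].
have IK : I * K = - J by rewrite -IJ mulrA II mulN1r.
have KJ : K * J = - I by rewrite -IJ -mulrA JJ mulrN1.
have JI : J * I = - K.
  rewrite -[J]opprK -IK mulNr; congr (- _).
  rewrite -mulrA -[I in K * I]opprK -KJ mulrN (mulrA K) KK mulN1r opprK.
  exact: IJ.
have JK : J * K = I by rewrite -IJ mulrA JI mulNr KJ opprK.
have KI : K * I = J by rewrite -IJ -mulrA JI mulrN IK opprK.
by [].
Qed.

(** The squares contribute minus the norm; the mixed terms pair up into
    commutators, (x y - y x) K and its cyclic analogues, which the relations turn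
    back into h times the quaternion itself. *)
Lemma sqr_quaternion (B : pzRingType) (x y z I J K h : B) :
  (forall v, v \in [:: x; y; z] ->
     [/\ GRing.comm I v, GRing.comm J v & GRing.comm K v]) ->
  [/\ I * I = -1, J * J = -1, K * K = -1 & I * J = K] ->
  [/\ x * y - y * x = h * z, y * z - z * y = h * x & z * x - x * z = h * y] ->
  (x * I + y * J + z * K) ^+ 2 =
    - (x ^+ 2 + y ^+ 2 + z ^+ 2) + h * (x * I + y * J + z * K).
Proof.
move=> cV units [Dxy Dyz Dzx]; rewrite !mulrDr !mulrA -Dxy -Dyz -Dzx.
have [II JJ KK IJ] := units.
have [JK KI JI KJ IK] := quaternion_table units.
have swap P b : GRing.comm P b ->
    forall a Q, (a * P) * (b * Q) = (a * b) * (P * Q).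
  by move=> cPb a Q; rewrite -!mulrA (mulrA P) cPb !mulrA.
have [cIx cJx cKx] := cV x (mem_head _ _).
have [|cIy cJy cKy] := cV y; first by rewrite !inE eqxx orbT.
have [|cIz cJz cKz] := cV z; first by rewrite !inE eqxx !orbT.
rewrite expr2 !mulrDl !mulrDr.
rewrite !(swap _ _ _ cIx, swap _ _ _ cIy, swap _ _ _ cIz, swap _ _ _ cJx,
  swap _ _ _ cJy, swap _ _ _ cJz, swap _ _ _ cKx, swap _ _ _ cKy,
  swap _ _ _ cKz) II JJ KK IJ JK KI JI KJ IK.
rewrite !mulrN !mulr1 !mulNr -!expr2 !opprD.
(* the three squares first, then the three pairs that form commutators *)
by rewrite [LHS](AC (3*3*3) ((1*5*9)*((6*8)*(7*3)*(2*4))))%AC.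
Qed.

(** * Functions of an element satisfying a central quadratic equation *)

Lemma mul_binomial (F : comPzRingType) (B : pzRingType) (s : {rmorphism F -> B})
    (N : B) (p q : F) :
  (forall c, GRing.comm (s c) N) -> N ^+ 2 = s p + s q * N ->
  forall a b c d, (s a + s b * N) * (s c + s d * N) =
    s (a * c + b * d * p) + s (a * d + b * c + b * d * q) * N.
Proof.
move=> sN N2 a b c d.
have lin : s b * N * s c = s (b * c) * N by rewrite -mulrA -sN mulrA -rmorphM.
have quad : s b * N * (s d * N) = s (b * d * p) + s (b * d * q) * N.
  rewrite mulrA -(mulrA _ N) -sN mulrA -rmorphM -mulrA -expr2 N2 mulrDr.
  by rewrite mulrA -!rmorphM.
rewrite mulrDl !mulrDr lin quad mulrA -!rmorphM !rmorphD !mulrDl.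
by rewrite [LHS](AC (2*(1*2)) ((1*4)*(2*3*5)))%AC.
Qed.

Section InverseRadialCube.
Variables (F : fieldType) (B : pzRingType) (s : {rmorphism F -> B}) (N P : B).
Variables (r e : F).
Hypothesis s_central : forall c, GRing.comm (s c) N.
Hypothesis sqrN : N ^+ 2 = s (- (r ^+ 2 + e ^+ 2)) + s (e *+ 2) * N.
Hypothesis defP : P = s ((r ^+ 2 - e ^+ 2) / r) + s (e / r) * N.
Hypotheses (r0 : r != 0) (re0 : r ^+ 2 + e ^+ 2 != 0).
Hypothesis (re2 : r ^+ 2 + (e *+ 2) ^+ 2 != 0).

(** On the two values r + d and r - d of P, where d^2 = - e^2, the function
    1 / (P (P^2 + e^2)) equals 1 / (r (r + d) (r + 2 d)) and
    1 / (r (r - d) (r - 2 d)). The affine function of P with these values,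
    rewritten in terms of N by defP, is the left factor; the factors r + 2 d and
    r - 2 d are the source of the denominator r^2 + (2 e)^2. *)
Lemma radial_inverse :
  (s (r * (r ^+ 2 + (e *+ 2) ^+ 2))^-1
   + s (- (3 * e / (r * (r ^+ 2 + e ^+ 2) * (r ^+ 2 + (e *+ 2) ^+ 2)))) * N)
  * (P * (P ^+ 2 + s (e ^+ 2))) = 1.
Proof.
have mulN := mul_binomial s_central sqrN.
have -> : P ^+ 2 + s (e ^+ 2) = s (r ^+ 2 - e ^+ 2 *+ 2) + s (e *+ 2) * N.
  rewrite expr2 defP mulN addrAC -rmorphD.
  by congr (s _ + s _ * N); field.
have -> : P * (s (r ^+ 2 - e ^+ 2 *+ 2) + s (e *+ 2) * N)
    = s (r ^+ 3 - 5 * r * e ^+ 2) + s (3 * r * e) * N.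
  by rewrite defP mulN; congr (s _ + s _ * N); field.
rewrite mulN -(rmorph1 s) -[RHS]addr0 -(mul0r N) -(rmorph0 s).
by congr (s _ + s _ * N); field; rewrite mulr_natr re2 re0 r0.
Qed.
End InverseRadialCube.

(** * The four-dimensional matrix quaternion units *)

Lemma comm_scalar_mx_central (B : pzRingType) n (c : B) (M : 'M[B]_n) :
  (forall i j, GRing.comm c (M i j)) -> c%:M *m M = M *m c%:M.
Proof.
move=> cM; rewrite -diag_const_mx mul_diag_mx mul_mx_diag.
by apply/matrixP => i j; rewrite !mxE cM.
Qed.

Lemma ord4_ind (P : 'I_4 -> Prop) :
  P ord0 -> P (inord 1) -> P (inord 2) -> P (inord 3) -> forall i, P i.
Proof.
move=> P0 P1 P2 P3 [[|[|[|[|i]]]] // Hi].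
- by rewrite (_ : Ordinal Hi = ord0) //; apply: val_inj.
- by rewrite (_ : Ordinal Hi = inord 1) //; apply: val_inj; rewrite /= inordK.
- by rewrite (_ : Ordinal Hi = inord 2) //; apply: val_inj; rewrite /= inordK.
- by rewrite (_ : Ordinal Hi = inord 3) //; apply: val_inj; rewrite /= inordK.
Qed.

Lemma sum_ord4 (V : nmodType) (G : 'I_4 -> V) :
  \sum_i G i = G ord0 + G (inord 1) + G (inord 2) + G (inord 3).
Proof.
rewrite !big_ord_recl big_ord0 addr0 !addrA.
by do !congr (_ + _); congr G; apply: val_inj; rewrite /= inordK.
Qed.

Section QuaternionMatrices.
Variable B : pzRingType.

(** The shape of the matrices in the definition of Theta, over any ring, so that
    the entrywise computations take place where the entries are variables. *)
Definition rows4 (rows : seq (seq B)) : 'M[B]_4 :=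
  \matrix_(i < 4, j < 4) nth 0 (nth [::] rows i) j.

Definition unitI : 'M[B]_4 := rows4
  [:: [:: 0; -1; 0; 0]; [:: 1; 0; 0; 0]; [:: 0; 0; 0; -1]; [:: 0; 0; 1; 0]].
Definition unitJ : 'M[B]_4 := rows4
  [:: [:: 0; 0; -1; 0]; [:: 0; 0; 0; 1]; [:: 1; 0; 0; 0]; [:: 0; -1; 0; 0]].
Definition unitK : 'M[B]_4 := rows4
  [:: [:: 0; 0; 0; -1]; [:: 0; 0; -1; 0]; [:: 0; 1; 0; 0]; [:: 1; 0; 0; 0]].

Let simp := (@mul0r B, @mulr0 B, @mul1r B, @mulr1 B, @mulN1r B, @mulrN1 B,
  @opprK B, @oppr0 B, @add0r B, @addr0 B, @mulr0n B, @mulr1n B).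

Lemma unit_relations :
  [/\ unitI * unitI = -1, unitJ * unitJ = -1, unitK * unitK = -1
    & unitI * unitJ = unitK].
Proof.
split; apply/matrixP; elim/ord4_ind; elim/ord4_ind;
  by rewrite !mxE sum_ord4 !mxE -?val_eqE /= ?inordK //= !simp.
Qed.

Lemma unit_comm (v : B) :
  [/\ GRing.comm unitI v%:M, GRing.comm unitJ v%:M & GRing.comm unitK v%:M].
Proof.
split; apply/esym; apply: comm_scalar_mx_central; elim/ord4_ind; elim/ord4_ind;
  by rewrite !mxE ?inordK //= /GRing.comm !simp.
Qed.

(** The matrix form of the position quaternion. *)
Definition posmx (x y z : B) : 'M[B]_4 :=
  x%:M * unitI + y%:M * unitJ + z%:M * unitK.

Lemma posmxE x y z :
  posmx x y z = rows4 [:: [:: 0; - x; - y; - z]; [:: x; 0; - z; y];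
                           [:: y; z; 0; - x]; [:: z; - y; x; 0]].
Proof.
rewrite /posmx -!mulmxE !mul_scalar_mx.
by apply/matrixP; elim/ord4_ind; elim/ord4_ind; rewrite !mxE ?inordK //= !simp.
Qed.

End QuaternionMatrices.

(** * Radial fields over an abstract central extension *)

Section CentralExtension.
Variables (F : fieldType) (B : pzRingType) (f : {rmorphism F -> B}).
Variables (x y z : B) (r e g : F).
Hypothesis f_central : forall c b, GRing.comm (f c) b.
Hypothesis su2 : [/\ x * y - y * x = f (e *+ 2) * z,
  y * z - z * y = f (e *+ 2) * x & z * x - x * z = f (e *+ 2) * y].
Hypothesis casimir : x ^+ 2 + y ^+ 2 + z ^+ 2 = f (r ^+ 2 + e ^+ 2).

Let scal : {rmorphism F -> 'M[B]_4} := scalar_mx \o f.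
Let N := posmx x y z.

Lemma scal_central c M : GRing.comm (scal c) M.
Proof. by apply: comm_scalar_mx_central => i j; exact: f_central. Qed.

Lemma sqr_posmx : N ^+ 2 = scal (- (r ^+ 2 + e ^+ 2)) + scal (e *+ 2) * N.
Proof.
have units_comm v : v \in [:: x%:M; y%:M; z%:M] ->
    [/\ GRing.comm (unitI B) v, GRing.comm (unitJ B) v
      & GRing.comm (unitK B) v].
  by rewrite !inE => /or3P[] /eqP->; exact: unit_comm.
have [Dxy Dyz Dzx] := su2.
have su2mx : [/\ x%:M * y%:M - y%:M * x%:M = scal (e *+ 2) * z%:M,
    y%:M * z%:M - z%:M * y%:M = scal (e *+ 2) * x%:M
    & z%:M * x%:M - x%:M * z%:M = scal (e *+ 2) * y%:M].
  split.
  - exact: (rmorph_commutator (@scalar_mx B 4) Dxy).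
  - exact: (rmorph_commutator (@scalar_mx B 4) Dyz).
  - exact: (rmorph_commutator (@scalar_mx B 4) Dzx).
rewrite /N /posmx (sqr_quaternion units_comm (unit_relations B) su2mx).
by rewrite (rmorph_sum_sqr (@scalar_mx B 4) casimir) rmorphN.
Qed.

(** The prescribed value of Theta at r, with r^2 + hbar^2 written r^2 - e^2. *)
Definition radius_image : 'M[B]_4 :=
  let d := f (r ^+ 2 - e ^+ 2) in
  let: (x, y, z) := (f e * x, f e * y, f e * z) in
  f r^-1 *: rows4
    [:: [:: d; - x; - y; - z]; [:: x; d; - z; y];
        [:: y; z; d; - x]; [:: z; - y; x; d]].

Lemma radius_imageE :
  radius_image = scal ((r ^+ 2 - e ^+ 2) / r) + scal (e / r) * N.
Proof.
rewrite ![_ / r]mulrC !(rmorphM scal) -mulrA -mulrDr /radius_image.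
rewrite -!mulmxE !mul_scalar_mx; congr (_ *: _).
rewrite /N posmxE; apply/matrixP; elim/ord4_ind; elim/ord4_ind;
  by rewrite !mxE -?val_eqE /= ?inordK //=
             ?(mulr0, mulrN, mulr0n, mulr1n, add0r, addr0).
Qed.

Let xmx := x%:M + f e *: unitI B.
Let ymx := y%:M + f e *: unitJ B.
Let zmx := z%:M + f e *: unitK B.

Lemma col_posmx (M : 'M[B]_4) :
  [/\ (N * M) (inord 1) ord0 =
        x * M ord0 ord0 - z * M (inord 2) ord0 + y * M (inord 3) ord0,
      (N * M) (inord 2) ord0 =
        y * M ord0 ord0 + z * M (inord 1) ord0 - x * M (inord 3) ord0
    & (N * M) (inord 3) ord0 =
        z * M ord0 ord0 - y * M (inord 1) ord0 + x * M (inord 2) ord0].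
Proof.
rewrite /N posmxE; split;
  by rewrite !mxE sum_ord4 !mxE ?inordK //= !mulNr mul0r addr0.
Qed.

Lemma col_coord :
  [/\ [/\ xmx ord0 ord0 = x, xmx (inord 1) ord0 = f e,
          xmx (inord 2) ord0 = 0 & xmx (inord 3) ord0 = 0],
      [/\ ymx ord0 ord0 = y, ymx (inord 1) ord0 = 0,
          ymx (inord 2) ord0 = f e & ymx (inord 3) ord0 = 0]
    & [/\ zmx ord0 ord0 = z, zmx (inord 1) ord0 = 0,
          zmx (inord 2) ord0 = 0 & zmx (inord 3) ord0 = f e]].
Proof.
do !split; by rewrite !mxE -?val_eqE /= ?inordK //=
                      ?(mulr0, mulr1, mulr0n, mulr1n, add0r, addr0).
Qed.

Lemma entry_radial a b M i j :
  ((scal a + scal b * N) * M) i j = f a * M i j + f b * (N * M) i j.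
Proof.
rewrite mulrDl -mulrA -!mulmxE mxE !mul_scalar_mx.
by congr (_ + _); rewrite mxE.
Qed.

(** W stands for the image under Theta of an arbitrary radial factor. *)
Section RadialField.
Variables a b : F.
Let W := scal a + scal b * N.

(** The scalar part of W contributes e three times; the N part contributes
    x^2 + y^2 + z^2, because row k of N vanishes in column k, where the shift e
    of the k-th coordinate sits. *)
Lemma div_radial :
  (W * xmx) (inord 1) ord0 + (W * ymx) (inord 2) ord0
    + (W * zmx) (inord 3) ord0
    = f (3 * e * a + b * (r ^+ 2 + e ^+ 2)).
Proof.
rewrite !entry_radial.
have [-> _ _] := col_posmx xmx; have [_ -> _] := col_posmx ymx.
have [_ _ ->] := col_posmx zmx.
have [[-> -> -> ->] [-> -> -> ->] [-> -> -> ->]] := col_coord.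
rewrite !mulr0 !(addr0, subr0) -!expr2.
have -> : 3 * e * a = a * e + a * e + a * e by ring.
rewrite !rmorphD !rmorphM -casimir !mulrDr.
by rewrite [LHS](AC (2*2*2) ((1*3*5)*(2*4*6)))%AC.
Qed.

(** Noncommutativity is compensated: y z - z y = 2 e x cancels the two terms
    e x that come from the shift of the coordinates by Theta. *)
Lemma rot_radial :
  [/\ (W * zmx) (inord 2) ord0 - (W * ymx) (inord 3) ord0 = 0,
      (W * xmx) (inord 3) ord0 - (W * zmx) (inord 1) ord0 = 0
    & (W * ymx) (inord 1) ord0 - (W * xmx) (inord 2) ord0 = 0].
Proof.
rewrite !entry_radial.
have [_ -> ->] := col_posmx xmx; have [-> _ ->] := col_posmx ymx.
have [-> -> _] := col_posmx zmx.
have [[-> -> -> ->] [-> -> -> ->] [-> -> -> ->]] := col_coord.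
rewrite !mulr0 !(addr0, add0r, subr0, sub0r).
have [Dxy Dyz Dzx] := su2.
have e_comm v : v * f e = f e * v by rewrite f_central.
rewrite -!mulrBr !e_comm.
have cancel p q s : p - q = f (e *+ 2) * s -> p - f e * s - (q + f e * s) = 0.
  move=> Dpq; rewrite opprD addrACA Dpq -opprD -mulrDl -rmorphD -mulr2n.
  by rewrite subrr.
by split; rewrite cancel ?mulr0.
Qed.
End RadialField.

Variable Theta : {rmorphism B -> 'M[B]_4}.
Hypotheses (Theta_e : Theta (f e) = scal e) (Theta_g : Theta (f g) = scal g).
Hypotheses (Theta_x : Theta x = xmx) (Theta_y : Theta y = ymx).
Hypotheses (Theta_z : Theta z = zmx) (Theta_r : Theta (f r) = radius_image).
Hypotheses (r_neq0 : r != 0) (re_neq0 : r ^+ 2 + e ^+ 2 != 0).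
Hypothesis re2_neq0 : r ^+ 2 + (e *+ 2) ^+ 2 != 0.

Let c := f (g / (r * (r ^+ 2 + e ^+ 2))).
Let w := r ^+ 2 + (e *+ 2) ^+ 2.

(** Theta is multiplicative, so it sends the inverse of r (r^2 + e^2) to the
    inverse of P (P^2 + e^2), which [radial_inverse] exhibits. *)
Lemma Theta_monopole_factor :
  Theta c = scal (g / (r * w))
    + scal (- (3 * e * g / (r * (r ^+ 2 + e ^+ 2) * w))) * N.
Proof.
pose V := scal (r * w)^-1
  + scal (- (3 * e / (r * (r ^+ 2 + e ^+ 2) * w))) * N.
have inv : V * (radius_image * (radius_image ^+ 2 + scal (e ^+ 2))) = 1.
  exact: (radial_inverse (fun d => scal_central d N) sqr_posmx radius_imageE).
have -> : scal (g / (r * w))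
    + scal (- (3 * e * g / (r * (r ^+ 2 + e ^+ 2) * w))) * N = scal g * V.
  rewrite [RHS]mulrDr mulrA -!(rmorphM scal); congr (_ + scal _ * _).
  by rewrite /w; field; rewrite mulr_natr re2_neq0 re_neq0 r_neq0.
have ThetaD : Theta (f (r * (r ^+ 2 + e ^+ 2)))
    = radius_image * (radius_image ^+ 2 + scal (e ^+ 2)).
  by rewrite !(rmorphM, rmorphD, rmorphXn) /= Theta_r Theta_e.
have Dinv : Theta (f (r * (r ^+ 2 + e ^+ 2)))
    * Theta (f (r * (r ^+ 2 + e ^+ 2))^-1) = 1.
  by rewrite -!rmorphM divff ?rmorph1 // mulf_neq0.
rewrite /c (rmorphM f) (rmorphM Theta) Theta_g; congr (_ * _).
by rewrite -[RHS]mulr1 -Dinv mulrA ThetaD inv mul1r.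
Qed.

Lemma monopole_div_rot :
  [/\ Theta (c * x) (inord 1) ord0 + Theta (c * y) (inord 2) ord0
        + Theta (c * z) (inord 3) ord0 = 0,
      Theta (c * z) (inord 2) ord0 - Theta (c * y) (inord 3) ord0 = 0,
      Theta (c * x) (inord 3) ord0 - Theta (c * z) (inord 1) ord0 = 0
    & Theta (c * y) (inord 1) ord0 - Theta (c * x) (inord 2) ord0 = 0].
Proof.
rewrite !(rmorphM Theta) Theta_x Theta_y Theta_z Theta_monopole_factor.
have [-> -> ->] := rot_radial (g / (r * w))
  (- (3 * e * g / (r * (r ^+ 2 + e ^+ 2) * w))).
split=> //; rewrite div_radial -[RHS](rmorph0 f); congr (f _).
by rewrite /w; field; rewrite mulr_natr re2_neq0 re_neq0 r_neq0.
Qed.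
End CentralExtension.

(** * The algebra extended by the quantum radius *)

Section CentralScalars.
Variables (K : fieldType) (h : K).

Lemma su2_scalar_zmod_morphism : zmod_morphism (su2_scalar h).
Proof. by move=> a b; rewrite /su2_scalar scalerBl rmorphB. Qed.

Lemma su2_scalar_monoid_morphism : monoid_morphism (su2_scalar h).
Proof.
split=> [|a b]; rewrite /su2_scalar; first by rewrite scale1r rmorph1.
by rewrite -rmorphM /= -scalerAl mul1r scalerA.
Qed.

HB.instance Definition _ :=
  GRing.isZmodMorphism.Build K (su2_env h) (su2_scalar h)
    su2_scalar_zmod_morphism.
HB.instance Definition _ :=
  GRing.isMonoidMorphism.Build K (su2_env h) (su2_scalar h)
    su2_scalar_monoid_morphism.

(** Scalars are supported on the empty word, which is neutral for concatenation
    on either side, and their coefficients commute because K is a field. *)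
Lemma free3_scalar_central (c : K) (a : free3 K) : c *: 1 * a = a * (c *: 1).
Proof.
rewrite -!mul_malgC mulr1 !malgM_def fgmulUg fgmulgU.
by apply: eq_bigr => k _; rewrite mul1m mulm1 mulrC.
Qed.

Lemma su2_scalar_central (c : K) (u : su2_env h) :
  GRing.comm (su2_scalar h c) u.
Proof.
rewrite -(tsquot_class_repr u) /GRing.comm /su2_scalar.
by rewrite -!rmorphM /= free3_scalar_central.
Qed.

Local Notation u i := (su2_gen h (inord i)).

Lemma su2_scalarE c (v : free3 K) :
  tsquot_class (su2_rel h) (c *: v) =
    su2_scalar h c * tsquot_class (su2_rel h) v.
Proof. by rewrite /su2_scalar -rmorphM /= -scalerAl mul1r. Qed.

Lemma su2_commutators :
  [/\ u 0 * u 1 - u 1 * u 0 = su2_scalar h h * u 2,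
      u 1 * u 2 - u 2 * u 1 = su2_scalar h h * u 0 &
      u 2 * u 0 - u 0 * u 2 = su2_scalar h h * u 1].
Proof.
split; rewrite -su2_scalarE; apply: (@tsquot_commutator _ (su2_rel h)).
- exact: su2_rel_xy.
- exact: su2_rel_yz.
- exact: su2_rel_zx.
Qed.
End CentralScalars.

Section Extension.
Variables (R : realType) (hbar : R[i]).
Local Notation A := (calA hbar).
Local Notation K := (ratfun R).

Lemma cst_zmod_morphism : zmod_morphism (@cst R).
Proof. by move=> a b; rewrite /cst !polyCB tofracB. Qed.

Lemma cst_monoid_morphism : monoid_morphism (@cst R).
Proof.
split=> [|a b]; rewrite /cst; first by rewrite polyC1; exact: tofrac1.
by rewrite !polyCM; exact: tofracM.
Qed.

HB.instance Definition _ :=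
  GRing.isZmodMorphism.Build R[i] K (@cst R) cst_zmod_morphism.
HB.instance Definition _ :=
  GRing.isMonoidMorphism.Build R[i] K (@cst R) cst_monoid_morphism.

Local Notation f_ := (@fA R hbar).

Lemma fA_zmod_morphism : zmod_morphism f_.
Proof. by move=> a b; rewrite /fA !rmorphB. Qed.

Lemma fA_monoid_morphism : monoid_morphism f_.
Proof. by split=> [|a b]; rewrite /fA ?rmorphM ?rmorph1. Qed.

HB.instance Definition _ :=
  GRing.isZmodMorphism.Build K A f_ fA_zmod_morphism.
HB.instance Definition _ :=
  GRing.isMonoidMorphism.Build K A f_ fA_monoid_morphism.

Lemma fA_central (f : K) (a : A) : GRing.comm (f_ f) a.
Proof.
rewrite -(tsquot_class_repr a) /GRing.comm /fA.
by rewrite -!rmorphM /= su2_scalar_central.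
Qed.

Local Notation x := (genx hbar).
Local Notation y := (geny hbar).
Local Notation z := (genz hbar).
Local Notation r := (rvar R).
Local Notation eta := (cst hbar).
Local Notation eps := (cst ('i%C * hbar)).

Lemma cst_hpar : cst (hpar hbar) = eps *+ 2.
Proof. by rewrite -rmorphMn /hpar -mulrA mulr_natl. Qed.

Lemma sqr_eps : eps ^+ 2 = - eta ^+ 2.
Proof. by rewrite -!rmorphXn -rmorphN exprMn sqr_i mulN1r. Qed.

Lemma calA_commutators :
  [/\ x * y - y * x = f_ (eps *+ 2) * z,
      y * z - z * y = f_ (eps *+ 2) * x &
      z * x - x * z = f_ (eps *+ 2) * y].
Proof.
have [Dxy Dyz Dzx] := su2_commutators (cst (hpar hbar)); rewrite -cst_hpar.
split.
- exact: (rmorph_commutator (tsquot_class (@casimir_rel R hbar)) Dxy).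
- exact: (rmorph_commutator (tsquot_class (@casimir_rel R hbar)) Dyz).
- exact: (rmorph_commutator (tsquot_class (@casimir_rel R hbar)) Dzx).
Qed.

Lemma calA_casimir : x ^+ 2 + y ^+ 2 + z ^+ 2 = f_ (r ^+ 2 - eta ^+ 2).
Proof.
rewrite [f_ _]/(tsquot_class _ _) rmorphB.
apply: (rmorph_casimir (f := tsquot_class (@casimir_rel R hbar))).
exact: tsquot_gen0.
Qed.

(** The quantum radius is an indeterminate over the complex numbers. *)
Lemma radius_sub_cst_neq0 (c : R[i]) : r - cst c != 0.
Proof.
rewrite /cst /rvar -rmorphB -rmorphB tofrac_eq0 /= polyC_eq0.
by rewrite polyXsubC_eq0.
Qed.

Lemma sqr_radius_sub_neq0 (c : R[i]) : r ^+ 2 - cst c ^+ 2 != 0.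
Proof.
rewrite subr_sqr mulf_neq0 ?radius_sub_cst_neq0 //.
by rewrite -[cst c]opprK -rmorphN radius_sub_cst_neq0.
Qed.

Lemma radius_neq0 : r != 0.
Proof. by have := radius_sub_cst_neq0 0; rewrite rmorph0 subr0. Qed.

Lemma theta_rE : theta_r hbar = radius_image f_ x y z r eps.
Proof. by rewrite /theta_r /radius_image sqr_eps opprK. Qed.

End Extension.

Theorem mainTheorem1 (R : realType) (hbar : R[i]) (hbar_neq0 : hbar != 0)
    (Theta : {rmorphism calA hbar -> 'M[calA hbar]_4})
    (Theta_spec : is_Theta Theta) (g : R) :
  qdiv Theta (monopole hbar g) = 0 /\
  qrot Theta (monopole hbar g) = (0, 0, 0).
Proof.
case: Theta_spec => Theta_C _ Theta_x Theta_y Theta_z.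
rewrite theta_rE => Theta_r.
have r2_eps :
    rvar R ^+ 2 - cst hbar ^+ 2 = rvar R ^+ 2 + cst ('i%C * hbar) ^+ 2.
  by rewrite sqr_eps.
have r2_neq0 : rvar R ^+ 2 + cst ('i%C * hbar) ^+ 2 != 0.
  by rewrite -r2_eps sqr_radius_sub_neq0.
(* this is r^2 - (2 hbar)^2, because (i hbar)^2 = - hbar^2 *)
have r2w_neq0 : rvar R ^+ 2 + (cst ('i%C * hbar) *+ 2) ^+ 2 != 0.
  rewrite exprMn_n sqr_eps mulNrn -exprMn_n -rmorphMn.
  exact: sqr_radius_sub_neq0.
have [div0 rot1 rot2 rot3] := monopole_div_rot (@fA_central R hbar)
  (calA_commutators hbar) (etrans (calA_casimir hbar) (congr1 _ r2_eps))
  (Theta_C _) (Theta_C g%:C%C) Theta_x Theta_y Theta_z Theta_r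
  (radius_neq0 R) r2_neq0 r2w_neq0.
rewrite /monopole r2_eps /qdiv /qrot /dx /dy /dz /qder.
have scale2 k a b : a - b = 0 -> k * a - k * b = 0 :> calA hbar.
  by move=> ab; rewrite -mulrBr ab mulr0.
split; last by congr (_, _, _); apply: scale2.
have scale3 k a b d : a + b + d = 0 -> k * a + k * b + k * d = 0 :> calA hbar.
  by move=> abd; rewrite -!mulrDr abd mulr0.
exact: scale3.
Qed.
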